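(* Let $q\ge 3$ be a power of a prime $p$, and let $\mathcal{C}$ be the DGZ curve. Then $\mathcal{C}(\mathbb{F}_{q^3})=\Lambda_3$, where $\Lambda_3$ is the set of all points of $PG(2,\mathbb{F}_{q^3})$ that lie on no line defined over $\mathbb{F}_q$.
   Context: Put $D_1(x,y,z)=\begin{vmatrix} x & x^q & x^{q^3}\\ y & y^q & y^{q^3}\\ z & z^q & z^{q^3}\end{vmatrix}$, $D_2(x,y,z)=\begin{vmatrix} x & x^q & x^{q^2}\\ y & y^q & y^{q^2}\\ z & z^q & z^{q^2}\end{vmatrix}$ and $F=D_1/D_2$, which is a homogeneous polynomial of degree $q^3-q^2$ over $\mathbb{F}_q$. The DGZ curve $\mathcal{C}$ is the plane curve over $\overline{\mathbb{F}}_q$ with equation $F(x,y,z)=0$; $\mathcal{C}(\mathbb{F}_{q^3})$ is the set of its points lying in $PG(2,\mathbb{F}_{q^3})$. The point-set of $PG(2,\mathbb{F}_{q^3})$ is partitioned into $\Lambda_1=PG(2,\mathbb{F}_q)$, the set $\Lambda_2$ of points of $PG(2,\mathbb{F}_{q^3})\setminus PG(2,\mathbb{F}_q)$ lying on some line of $PG(2,\mathbb{F}_q)$ (line with an equation over $\mathbb{F}_q$), and the set $\Lambda_3$ of all remaining points; one has $|\Lambda_3|=q^6-q^5-q^4+q^3$. *)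

(* Defs.v *)
From HB Require Import structures.
From mathcomp Require Import all_boot all_order all_fingroup all_algebra all_solvable all_field.
From mathcomp Require Import mpoly ring.

Set Implicit Arguments.
Unset Strict Implicit.
Unset Printing Implicit Defensive.

Import GRing.Theory.
Local Open Scope ring_scope.

(* With [:: 0; 1; 3] and [:: 0; 1; 2] as exponents this gives D_1 and D_2,
   where q is the cardinal of the ground field. *)
Definition frob_det (Fq : finFieldType) (e : seq nat) : {mpoly Fq[3]} :=
  \det (\matrix_(i < 3, j < 3) 'X_i ^+ (#|Fq| ^ nth 0 e j)).

Definition D1 (Fq : finFieldType) : {mpoly Fq[3]} := frob_det Fq [:: 0; 1; 3]%N.
Definition D2 (Fq : finFieldType) : {mpoly Fq[3]} := frob_det Fq [:: 0; 1; 2]%N.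

(* The monic q-polynomial vanishing at x, y and z has its coefficients in the
   ring generated by x, y and z. *)
Lemma qpoly_annihilator (R : comNzRingType) (q : nat) (x y z : R) :
    (0 < q)%N -> {morph (fun t : R => t ^+ q) : s t / s - t} ->
  exists A B C : R, forall t, t \in [:: x; y; z] ->
    t ^+ (q ^ 3) = A * t ^+ (q ^ 2) + B * t ^+ q + C * t.
Proof.
move=> q0 fB.
have expq (t : R) : t ^+ q.-1 * t = t ^+ q by rewrite -exprSr prednK.
pose a := x ^+ q.-1; pose L1 t : R := t ^+ q - a * t.
pose b := L1 y ^+ q.-1; pose L2 t : R := L1 t ^+ q - b * L1 t.
pose c := L2 z ^+ q.-1; pose L3 t : R := L2 t ^+ q - c * L2 t.
have q0n : (0 : R) ^+ q = 0 by rewrite expr0n eqn0Ngt q0.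
have L1x : L1 x = 0 by rewrite /L1 expq subrr.
have L2x : L2 x = 0 by rewrite /L2 L1x mulr0 q0n subrr.
have L2y : L2 y = 0 by rewrite /L2 expq subrr.
have L30 t : t \in [:: x; y; z] -> L3 t = 0.
  rewrite !inE => /or3P[] /eqP->; last by rewrite /L3 expq subrr.
    by rewrite /L3 L2x mulr0 q0n subrr.
  by rewrite /L3 L2y mulr0 q0n subrr.
have fN (t : R) : (- t) ^+ q = - t ^+ q.
  by have := fB 0 t; rewrite /= q0n !sub0r.
have fD (s t : R) : (s + t) ^+ q = s ^+ q + t ^+ q.
  by have := fB s (- t); rewrite /= fN !opprK.
exists ((a ^+ q + b) ^+ q + c), (- (a * b) ^+ q - c * (a ^+ q + b)), (c * (a * b)).
move=> t /L30 Lt.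
have L2E : L2 t = t ^+ q ^+ q - (a ^+ q + b) * t ^+ q + a * b * t.
  by rewrite /L2 /L1 fB exprMn; ring.
have e2 : t ^+ (q ^ 2) = t ^+ q ^+ q by rewrite expnS expn1 exprM.
have e3 : t ^+ (q ^ 3) = t ^+ q ^+ q ^+ q by rewrite !expnS expn0 muln1 !exprM.
have : t ^+ q ^+ q ^+ q = L3 t + ((a ^+ q + b) ^+ q + c) * t ^+ q ^+ q
   + (- (a * b) ^+ q - c * (a ^+ q + b)) * t ^+ q + c * (a * b) * t.
  by rewrite /L3 L2E fD fB exprMn (exprMn _ (a * b)); ring.
by rewrite Lt add0r e2 e3.
Qed.

Lemma mpoly_frobB (Fq : finFieldType) (n : nat) :
  {morph (fun t : {mpoly Fq[n]} => t ^+ #|Fq|) : s t / s - t}.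
Proof.
have [p p_pr pF] := finPcharP Fq.
have pP : p \in [pchar {mpoly Fq[n]}] by rewrite pchar_lalg.
have qp : [pchar {mpoly Fq[n]}].-nat #|Fq|.
  rewrite (eq_pnat _ (pcharf_eq pP)) -cardsT.
  exact: abelem_pgroup (fin_ring_pchar_abelem pF).
by move=> s t /=; apply/esym/eqP; rewrite subr_eq -(exprDn_pchar _ _ qp) subrK.
Qed.

Lemma det_mx33 (R : comNzRingType) (f : 'I_3 -> 'I_3 -> R) :
  let i0 := inord 0 in let i1 := inord 1 in let i2 := inord 2 in
  \det (\matrix_(i, j) f i j) =
    f i0 i0 * (f i1 i1 * f i2 i2 - f i1 i2 * f i2 i1)
  - f i0 i1 * (f i1 i0 * f i2 i2 - f i1 i2 * f i2 i0)
  + f i0 i2 * (f i1 i0 * f i2 i1 - f i1 i1 * f i2 i0).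
Proof.
move=> i0 i1 i2.
rewrite (expand_det_row _ ord0) !big_ord_recl big_ord0 /cofactor.
rewrite !(expand_det_row _ ord0) !big_ord_recl !big_ord0 /cofactor !det_mx11 !mxE.
pose g a b := f (inord a) (inord b).
have fE i j : f i j = g i j by rewrite /g !inord_val.
by rewrite !fE /= !inordK //= /bump /=; ring.
Qed.

Lemma D2_dvd_D1 (Fq : finFieldType) : exists F, F * D2 Fq == D1 Fq.
Proof.
have q0 : (0 < #|Fq|)%N by apply: ltnW; apply: finNzRing_gt1.
have [F [B [C FE]]] :=
  @qpoly_annihilator {mpoly Fq[3]} #|Fq| 'X_(inord 0) 'X_(inord 1) 'X_(inord 2)
    q0 (@mpoly_frobB Fq 3).
exists F; apply/eqP; rewrite /D1 /D2 /frob_det !det_mx33 !inordK //=.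
rewrite !FE ?inE ?eqxx ?orbT // expn0 expn1; ring.
Qed.

(* F = D_1 / D_2; see DGZ_polyE and DGZ_poly_uniq. *)
Definition DGZ_poly (Fq : finFieldType) : {mpoly Fq[3]} := xchoose (D2_dvd_D1 Fq).

Lemma DGZ_polyE (Fq : finFieldType) : DGZ_poly Fq * D2 Fq = D1 Fq.
Proof. exact/eqP/(xchooseP (D2_dvd_D1 Fq)). Qed.

Lemma D2_neq0 (Fq : finFieldType) : D2 Fq != 0.
Proof.
have q1 : (1 < #|Fq|)%N by apply: finNzRing_gt1.
pose m (s : 'S_3) : 'X_{1..3} := [multinom (#|Fq| ^ s i)%N | i < 3].
have m_inj : injective m.
  move=> s t /mnmP est; apply/permP => i; apply: val_inj.
  by have := est i; rewrite !mnmE => /eqP; rewrite eqn_exp2l // => /eqP.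
have DE : D2 Fq = \sum_(s : 'S_3) (-1) ^+ s *: 'X_[m s].
  apply: eq_bigr => s _; rewrite mpolyXE_id mulr_sign scaler_sign.
  suff -> : \prod_i (\matrix_(i < 3, j < 3)
      'X_i ^+ (#|Fq| ^ nth 0 [:: 0; 1; 2] j)) i (s i)
    = \prod_i 'X_i ^+ m s i :> {mpoly Fq[3]} by [].
  apply: eq_bigr => i _; rewrite mxE mnmE.
  by case: (s i) => [[|[|[|]]]].
apply/negP => /eqP D0; have /eqP := congr1 (mcoeff (m 1%g)) D0.
rewrite DE raddf_sum mcoeff0 (bigD1 1%g) //= mcoeffZ mcoeffX eqxx odd_perm1 mul1r.
rewrite big1 ?addr0 ?oner_eq0 // => s s1.
by rewrite mcoeffZ mcoeffX (inj_eq m_inj) (negPf s1) mulr0.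
Qed.

Lemma DGZ_poly_uniq (Fq : finFieldType) (F : {mpoly Fq[3]}) :
  F * D2 Fq = D1 Fq -> F = DGZ_poly Fq.
Proof. by rewrite -DGZ_polyE => /(mulIf (D2_neq0 Fq)). Qed.

(* A point is a line through the origin of K^3, that is, the set of its
   homogeneous coordinate vectors together with 0. *)
Definition PG2 (K : fieldType) : Type := {V : {vspace 'rV[K]_3} | \dim V == 1%N}.

Definition PG2_over (E K : fieldType) (j : {rmorphism E -> K}) (P : PG2 K) : Prop :=
  exists2 v : 'rV[E]_3, v != 0 & map_mx j v \in val P.

(* The line with equation l_0 x + l_1 y + l_2 z = 0, for l != 0. *)
Definition on_line (K : fieldType) (l : 'rV[K]_3) (P : PG2 K) : Prop :=
  forall v : 'rV[K]_3, v \in val P -> \sum_(k < 3) l 0 k * v 0 k = 0.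

(* For homogeneous F of positive degree one nonzero v would be enough. *)
Definition on_curve (K : fieldType) (F : {mpoly K[3]}) (P : PG2 K) : Prop :=
  forall v : 'rV[K]_3, v \in val P -> F.@[v 0] = 0.

Definition DGZ_curve (Fq : finFieldType) (K : fieldType) (i : {rmorphism Fq -> K})
  (P : PG2 K) : Prop := on_curve (map_mpoly i (DGZ_poly Fq)) P.

(* PG(2, q^3) is seen inside PG(2, K) along j, and a line is defined over Fq
   when it has an equation with coefficients in the image of Fq. *)
Definition Lambda3 (Fq : finFieldType) (E K : fieldType)
  (i : {rmorphism Fq -> E}) (j : {rmorphism E -> K}) (P : PG2 K) : Prop :=
  PG2_over j P /\
  forall l : 'rV[Fq]_3, l != 0 -> ~ on_line (map_mx (j \o i) l) P.

(* Main.v *)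
Require Import Defs.
From mathcomp Require Import all_boot all_order all_fingroup all_algebra.
From mathcomp Require Import all_solvable all_field.
From mathcomp Require Import mpoly ring.

Set Implicit Arguments.
Unset Strict Implicit.
Unset Printing Implicit Defensive.

Import GRing.Theory.
Local Open Scope ring_scope.

(* The monic [q]-polynomial vanishing at [x], [y], [z] is the composition
   [(phi - c) (phi - b) (phi - a)], with [phi] the [q]-Frobenius,
   [a = x ^ (q - 1)], [b = (L1 y) ^ (q - 1)], [c = (L2 z) ^ (q - 1)],
   [L1 = phi - a] and [L2 = (phi - b) (phi - a)].  Reducing the columns of
   [D_1] and [D_2] with it gives [D_2 = x (L1 y) (L2 z)] and
   [F = a ^ (q ^ 2) + b ^ q + c].  For [x], [y], [z] in the field with [q ^ 3]
   elements [D_1] vanishes, its first and last columns being equal, so [F = 0]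
   as soon as [D_2 <> 0], that is, as soon as [x], [y], [z] are linearly
   independent over [F_q].  If they are dependent, [F] is the [q]-th power of
   the binary form [u ^ (q (q - 1)) + (v ^ q - u ^ (q - 1) v) ^ (q - 1)] at
   two of them; a zero [(u, v)] would make [v / u] fixed by [phi ^ 2] and
   [phi ^ 3], hence by [phi]; then [v] is in [F_q u], the second term vanishes,
   and [u = v = 0]. *)

Definition moore1 (R : comNzRingType) q (x t : R) : R := t ^+ q - x ^+ q.-1 * t.

Definition moore2 (R : comNzRingType) q (x y t : R) : R :=
  moore1 q x t ^+ q - moore1 q x y ^+ q.-1 * moore1 q x t.

(** Kept over an arbitrary commutative ring, so that it applies both to the indeterminates of
    [DGZ_poly] and to coordinates in a field. *)
Definition DGZ_form (R : comNzRingType) q (x y z : R) : R :=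
  (x ^+ q.-1) ^+ q ^+ q + (moore1 q x y ^+ q.-1) ^+ q + moore2 q x y z ^+ q.-1.

Section FrobeniusDet.
Variables (R : comNzRingType) (q : nat).
Hypotheses (q_gt0 : (0 < q)%N) (frobB : {morph (fun t : R => t ^+ q) : s t / s - t}).

Lemma frob0 : 0 ^+ q = 0 :> R.
Proof. by rewrite expr0n eqn0Ngt q_gt0. Qed.

Lemma frobD (s t : R) : (s + t) ^+ q = s ^+ q + t ^+ q.
Proof.
have frobN (u : R) : (- u) ^+ q = - u ^+ q.
  by have := frobB 0 u; rewrite /= frob0 !sub0r.
by have := frobB s (- t); rewrite /= frobN !opprK.
Qed.

Lemma expr_predK (t : R) : t ^+ q.-1 * t = t ^+ q.
Proof. by rewrite -exprSr prednK. Qed.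

Lemma moore1xx (x : R) : moore1 q x x = 0.
Proof. by rewrite /moore1 expr_predK subrr. Qed.

Lemma moore1_linear (x a s t : R) : a ^+ q = a ->
  moore1 q x (a * s + t) = a * moore1 q x s + moore1 q x t.
Proof. by rewrite /moore1 frobD exprMn => ->; ring. Qed.

Lemma moore1_0r (x : R) : moore1 q x 0 = 0.
Proof. by rewrite /moore1 frob0 mulr0 subrr. Qed.

(** Scaling multiplies [moore1] by [c ^ q] and [moore2] by [c ^ (q ^ 2)], so all three summands have
    degree [q ^ 2 * (q - 1)]. One coordinate vector thus decides whether a point is on the curve. *)
Lemma DGZ_formZ (c x y z : R) :
  DGZ_form q (c * x) (c * y) (c * z) = (c ^+ q.-1) ^+ q ^+ q * DGZ_form q x y z.
Proof.
have m1 t : moore1 q (c * x) (c * t) = c ^+ q * moore1 q x t.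
  by rewrite /moore1 !exprMn -(expr_predK c); ring.
have m2 : moore2 q (c * x) (c * y) (c * z) = c ^+ q ^+ q * moore2 q x y z.
  rewrite /moore2 !m1 !exprMn -(expr_predK (c ^+ q)); ring.
rewrite /DGZ_form m2 m1 !exprMn !mulrDr; congr (_ + _ * _ + _ * _).
  by rewrite -!exprM; congr (_ ^+ _); ring.
by rewrite -!exprM; congr (_ ^+ _); ring.
Qed.

(* The powers are abstracted as [e] to keep [ring] from normalising them. *)
Lemma moore_dets (x y z : R) (e : nat -> R -> R) :
  (forall k t, e k t = t ^+ (q ^ k)) ->
  let det3 n := x * (e 1 y * e n z - e n y * e 1 z)
    - e 1 x * (y * e n z - e n y * z) + e n x * (y * e 1 z - e 1 y * z) in
  det3 2 = x * moore1 q x y * moore2 q x y z /\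
  det3 3 = DGZ_form q x y z * det3 2.
Proof.
move=> eE det3.
have e1 t : e 1%N t = t ^+ q by rewrite eE expn1.
have eS k t : e k.+1 t = e k t ^+ q by rewrite !eE expnSr exprM.
have m2 t : moore1 q x t ^+ q
    = moore2 q x y t + moore1 q x y ^+ q.-1 * moore1 q x t.
  by rewrite /moore2 subrK.
have x1 : e 1%N x = x ^+ q.-1 * x by rewrite e1 expr_predK.
have y1 : e 1%N y = moore1 q x y + x ^+ q.-1 * y by rewrite e1 /moore1 subrK.
have z1 : e 1%N z = moore1 q x z + x ^+ q.-1 * z by rewrite e1 /moore1 subrK.
(* From here on, each relation is the [q]-th power of the one a level below. *)
have x2 : e 2%N x = (x ^+ q.-1) ^+ q * e 1%N x.
  by rewrite (eS 1%N x) {1}x1 exprMn -(e1 x).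
have y2 : e 2%N y = moore1 q x y ^+ q.-1 * moore1 q x y + (x ^+ q.-1) ^+ q * e 1%N y.
  by rewrite (eS 1%N y) {1}y1 frobD exprMn expr_predK -(e1 y).
have z2 : e 2%N z = moore2 q x y z + moore1 q x y ^+ q.-1 * moore1 q x z
    + (x ^+ q.-1) ^+ q * e 1%N z.
  by rewrite (eS 1%N z) {1}z1 frobD exprMn -(e1 z) (m2 z).
have x3 : e 3%N x = (x ^+ q.-1) ^+ q ^+ q * e 2%N x.
  by rewrite (eS 2%N x) {1}x2 exprMn -(eS 1%N x).
have y3 : e 3%N y = (moore1 q x y ^+ q.-1) ^+ q
    * (moore1 q x y ^+ q.-1 * moore1 q x y) + (x ^+ q.-1) ^+ q ^+ q * e 2%N y.
  by rewrite (eS 2%N y) {1}y2 frobD !exprMn -(eS 1%N y) expr_predK.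
have z3 : e 3%N z = moore2 q x y z ^+ q.-1 * moore2 q x y z
    + (moore1 q x y ^+ q.-1) ^+ q
      * (moore2 q x y z + moore1 q x y ^+ q.-1 * moore1 q x z)
    + (x ^+ q.-1) ^+ q ^+ q * e 2%N z.
  rewrite (eS 2%N z) {1}z2 2!frobD !exprMn -(eS 1%N z) (m2 z).
  by rewrite (expr_predK (moore2 q x y z)).
rewrite /det3 /DGZ_form x3 y3 z3 x2 y2 z2 x1 y1 z1.
split; ring.
Qed.

End FrobeniusDet.

Lemma rmorph_moore1 (R S : comNzRingType) (f : {rmorphism R -> S}) q x t :
  f (moore1 q x t) = moore1 q (f x) (f t).
Proof. by rewrite rmorphB rmorphM !rmorphXn. Qed.

Lemma rmorph_DGZ_form (R S : comNzRingType) (f : {rmorphism R -> S}) q x y z :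
  f (DGZ_form q x y z) = DGZ_form q (f x) (f y) (f z).
Proof.
by rewrite !rmorphD !rmorphXn rmorphB rmorphM !rmorphXn !rmorph_moore1.
Qed.

Lemma DGZ_poly_form (Fq : finFieldType) :
  DGZ_poly Fq = DGZ_form #|Fq| 'X_(inord 0) 'X_(inord 1) 'X_(inord 2).
Proof.
have q0 : (0 < #|Fq|)%N by apply: ltnW; apply: finNzRing_gt1.
apply/esym/DGZ_poly_uniq.
have [_] := moore_dets q0 (@mpoly_frobB Fq 3) 'X_(inord 0) 'X_(inord 1)
  'X_(inord 2) (fun k t => erefl (t ^+ (#|Fq| ^ k))).
by rewrite /D1 /D2 /frob_det !det_mx33 !inordK //= expn0 !expr1 => ->.
Qed.

Lemma meval_DGZ_poly (Fq : finFieldType) (K : comNzRingType)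
    (f : {rmorphism Fq -> K}) (v : 'I_3 -> K) :
  (map_mpoly f (DGZ_poly Fq)).@[v]
  = DGZ_form #|Fq| (v (inord 0)) (v (inord 1)) (v (inord 2)).
Proof.
by rewrite DGZ_poly_form !rmorph_DGZ_form /= !map_mpolyX !mevalXU.
Qed.

Lemma rmorph_frobB (Fq : finFieldType) (R : comNzRingType)
    (f : {rmorphism Fq -> R}) : {morph (fun t : R => t ^+ #|Fq|) : s t / s - t}.
Proof.
have [p p_pr pF] := finPcharP Fq.
have qp : [pchar R].-nat #|Fq|.
  rewrite (eq_pnat _ (pcharf_eq (rmorph_pchar f pF))) -cardsT.
  exact: abelem_pgroup (fin_ring_pchar_abelem pF).
by move=> s t /=; apply/esym/eqP; rewrite subr_eq -(exprDn_pchar _ _ qp) subrK.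
Qed.

(** The polynomial [X ^ q - X] already splits over [Fq], so its roots in [E] all come from [Fq]. *)
Lemma frob_fixed_im (Fq : finFieldType) (E : fieldType)
    (f : {rmorphism Fq -> E}) (s : E) : s ^+ #|Fq| = s -> exists c, s = f c.
Proof.
move=> sq; have := congr1 (map_poly f) (finField_genPoly Fq).
rewrite rmorphB /= map_polyXn map_polyX rmorph_prod /= => /(congr1 (horner^~ s)).
rewrite !hornerE sq subrr horner_prod => /esym/eqP/prodf_eq0[c _].
by rewrite map_polyXsubC hornerXsubC subr_eq0 => /eqP->; exists c.
Qed.

Lemma sum_ord3 (V : nmodType) (F : 'I_3 -> V) :
  \sum_k F k = F (inord 0) + F (inord 1) + F (inord 2).
Proof.
rewrite !big_ord_recr big_ord0 /= add0r; congr (F _ + F _ + F _);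
  by apply: val_inj; rewrite /= inordK.
Qed.

Lemma row3_neq0 (R : nmodType) (u : 'rV[R]_3) : (u != 0) =
  [|| u 0 (inord 0) != 0, u 0 (inord 1) != 0 | u 0 (inord 2) != 0].
Proof.
apply/idP/idP => [|u_nz]; last first.
  by apply: contraTneq u_nz => ->; rewrite !mxE eqxx.
apply: contraR; rewrite !negb_or !negbK => /and3P[/eqP u0 /eqP u1 /eqP u2].
apply/eqP/rowP => k; rewrite mxE -(inord_val k).
by case: k => [[|[|[|]]]].
Qed.

Section CubicPoints.
Variables (Fq E : finFieldType) (i : {rmorphism Fq -> E}).
Let q := #|Fq|.
Hypothesis card_E : #|E| = (q ^ 3)%N.

Let q_gt0 : (0 < q)%N. Proof. by apply: ltnW; apply: finNzRing_gt1. Qed.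
Let frobBE : {morph (fun t : E => t ^+ q) : s t / s - t} := rmorph_frobB i.
Let iq c : i c ^+ q = i c. Proof. by rewrite -rmorphXn expf_card. Qed.
Let E3 (t : E) : t ^+ q ^+ q ^+ q = t.
Proof. by rewrite -!exprM -[RHS]expf_card card_E !expnS expn0 muln1 mulnA. Qed.

(** The equation says that [t / x] is fixed by the [q]-Frobenius. *)
Lemma moore1_eq0 (x t : E) : x != 0 -> moore1 q x t = 0 -> exists c, t = i c * x.
Proof.
move=> x0 /eqP; rewrite subr_eq0 => /eqP tq.
have [|c cE] := @frob_fixed_im _ _ i (t / x); last by exists c; rewrite -cE divfK.
by rewrite expr_div_n tq -(expr_predK q_gt0 x); field; rewrite x0 expf_neq0.
Qed.

Let q1_gt0 : (0 < q.-1)%N.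
Proof. by rewrite -ltnS prednK //; apply: finNzRing_gt1. Qed.
Let zeroX1 : 0 ^+ q.-1 = 0 :> E. Proof. by rewrite expr0n eqn0Ngt q1_gt0. Qed.
Let moore10 (t : E) : moore1 q 0 t = t ^+ q.
Proof. by rewrite /moore1 zeroX1 mul0r subr0. Qed.

(* Multiplying by [moore1 q x y] gives [y ^ (q ^ 2) - x ^ (q ^ 2 - 1) * y]. *)
Lemma DGZ_form2_neq0 (x y : E) : (x != 0) || (y != 0) ->
  (x ^+ q.-1) ^+ q + moore1 q x y ^+ q.-1 != 0.
Proof.
have [->|x0 _] := eqVneq x 0.
  by rewrite zeroX1 (frob0 _ q_gt0) add0r moore10 => ?; rewrite !expf_neq0.
have [->|m0] := eqVneq (moore1 q x y) 0.
  by rewrite zeroX1 addr0 !expf_neq0.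
apply: contra_neq m0 => A0.
have y2 : y ^+ q ^+ q = (x ^+ q.-1) ^+ q * x ^+ q.-1 * y.
  have : ((x ^+ q.-1) ^+ q + moore1 q x y ^+ q.-1) * moore1 q x y = 0.
    by rewrite A0 mul0r.
  rewrite mulrDl (expr_predK q_gt0) {2}/moore1 frobBE exprMn {1}/moore1.
  by move=> eq0; apply/eqP; rewrite -subr_eq0 -eq0; apply/eqP; ring.
have t2 : (y / x) ^+ q ^+ q = y / x.
  have x2 : x ^+ q ^+ q = (x ^+ q.-1) ^+ q * x ^+ q.-1 * x.
    by rewrite -{1}(expr_predK q_gt0 x) exprMn -mulrA expr_predK.
  by rewrite !expr_div_n y2 x2 -mulf_div mulfV ?mul1r // mulf_neq0 ?expf_neq0.
have t1 : (y / x) ^+ q = y / x by rewrite -{1}t2 E3.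
rewrite /moore1 -{1}(divfK x0 y) exprMn t1 -(expr_predK q_gt0 x); field.
exact: x0.
Qed.

(** The relation forces [x], [moore1 q x y] or [moore2 q x y z] to vanish. According to which is the
    first to do so, the form is the [q]-th power of the binary form at [(y, z)], [(x, z)] or
    [(x, y)]. *)
Lemma DGZ_form_line_neq0 (x y z : E) (a b c : Fq) :
    [|| x != 0, y != 0 | z != 0] -> [|| a != 0, b != 0 | c != 0] ->
  i a * x + i b * y + i c * z = 0 -> DGZ_form q x y z != 0.
Proof.
have [->|x0 _] := eqVneq x 0.
  move=> /= yz _ _.
  have -> : DGZ_form q 0 y z = ((y ^+ q.-1) ^+ q + moore1 q y z ^+ q.-1) ^+ q.
    rewrite /DGZ_form /moore2 !moore10 zeroX1 !(frob0 _ q_gt0) add0r.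
    rewrite (frobD q_gt0 frobBE); congr (_ + _).
      by congr (_ ^+ _); exact: exprAC.
    rewrite [RHS]exprAC; congr (_ ^+ _).
    by rewrite /moore1 frobBE exprMn (exprAC y).
  exact/expf_neq0/DGZ_form2_neq0.
have [m0|m0] := eqVneq (moore1 q x y) 0 => abc line.
  have -> : DGZ_form q x y z = ((x ^+ q.-1) ^+ q + moore1 q x z ^+ q.-1) ^+ q.
    rewrite /DGZ_form /moore2 m0 zeroX1 (frob0 _ q_gt0) addr0 mul0r subr0.
    by rewrite [RHS](frobD q_gt0 frobBE) (exprAC (moore1 q x z)).
  by rewrite expf_neq0 // DGZ_form2_neq0 // x0.
(* The [F_q]-linear map [moore1 q x] kills the [x] term of the relation. *)
have line1 : i b * moore1 q x y + i c * moore1 q x z = 0.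
  have := congr1 (moore1 q x) line.
  rewrite -addrA !(moore1_linear q_gt0 frobBE) // moore1xx // mulr0 add0r.
  rewrite -(addr0 (i c * z)) (moore1_linear q_gt0 frobBE) //.
  by rewrite moore1_0r // addr0.
(* The map [t ^ q - b t], with [b] the [(q - 1)]-th power of [moore1 q x y], now kills the [y]
   term. *)
have line2 : i c * moore2 q x y z = 0.
  have /= := congr1 (fun t => t ^+ q - moore1 q x y ^+ q.-1 * t) line1.
  rewrite (frobD q_gt0 frobBE) !exprMn !iq (frob0 _ q_gt0) mulr0 subr0 => <-.
  by rewrite -(expr_predK q_gt0 (moore1 q x y)) /moore2; ring.
have m2 : moore2 q x y z = 0.
  (* Otherwise, climbing back through the three relations gives [c = 0], then [b = 0], then
     [a = 0]. *)
  apply: contraTeq abc => m2.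
  move/eqP: line2; rewrite mulf_eq0 (negPf m2) orbF fmorph_eq0 => /eqP c0.
  move/eqP: line1; rewrite c0 rmorph0 mul0r addr0 mulf_eq0 (negPf m0) orbF.
  rewrite fmorph_eq0 => /eqP b0.
  move/eqP: line; rewrite c0 b0 rmorph0 !mul0r !addr0 mulf_eq0 (negPf x0) orbF.
  by rewrite fmorph_eq0 => /eqP->; rewrite eqxx.
rewrite /DGZ_form m2 zeroX1 addr0 -(frobD q_gt0 frobBE) expf_neq0 //.
by rewrite DGZ_form2_neq0 // x0.
Qed.

Lemma DGZ_form_no_line (x y z : E) :
    (forall a b c, [|| a != 0, b != 0 | c != 0] ->
      i a * x + i b * y + i c * z != 0) ->
  DGZ_form q x y z = 0.
Proof.
move=> noline.
have x0 : x != 0.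
  have := noline 1 0 0; rewrite rmorph1 rmorph0 !mul0r !addr0 mul1r.
  by apply; rewrite oner_eq0.
have m1 : moore1 q x y != 0.
  apply/eqP => /(moore1_eq0 x0)[c yE].
  (* As [y = c x], the point would lie on the line [(c, -1, 0)]. *)
  have /eqP[] := noline c (-1) 0 ltac:(by rewrite oppr_eq0 oner_eq0 orbT).
  by rewrite yE rmorph0 rmorphN1; ring.
have m2 : moore2 q x y z != 0.
  apply/eqP => /(moore1_eq0 m1)[c zE].
  (* Here [moore1 q x z = c * moore1 q x y], so [z - c y] is some [d x], and the point would lie on
     the line [(d, c, -1)]. *)
  have : moore1 q x (- i c * y + z) = 0.
    rewrite (moore1_linear q_gt0 frobBE) ?zE; first ring.
    by rewrite -rmorphN iq.
  move/(moore1_eq0 x0) => [d dE].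
  have /eqP[] := noline d c (-1) ltac:(by rewrite oppr_eq0 oner_eq0 !orbT).
  by rewrite -dE rmorphN1; ring.
have [D2E] := moore_dets q_gt0 frobBE x y z (fun k t => erefl (t ^+ (q ^ k))).
rewrite -card_E !expf_card D2E.
(* Since [t ^ (q ^ 3) = t] on [E], the first and last columns of [D_1] agree. *)
set D3 := (X in X = _ -> _); have -> : D3 = 0 by rewrite /D3; ring.
move/esym/eqP; rewrite !mulf_eq0 (negPf x0) (negPf m1) (negPf m2) !orbF.
by move/eqP.
Qed.

End CubicPoints.

Theorem lemma4p9 (p h q : nat) (Fq Fq3 : finFieldType) (K : closedFieldType)
    (i : {rmorphism Fq -> Fq3}) (j : {rmorphism Fq3 -> K})
    (p_prime : prime p) (q_pow : q = (p ^ h)%N) (q_ge3 : (3 <= q)%N)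
    (card_Fq : #|Fq| = q) (card_Fq3 : #|Fq3| = (q ^ 3)%N)
    (K_alg : forall x : K, algebraicOver (j \o i) x) :
  forall P : PG2 K,
    (DGZ_curve (j \o i) P /\ PG2_over j P) <-> Lambda3 i j P.
Proof.
(* Both sides contain [PG2_over j P], so a coordinate vector [w] over [Fq3] can be fixed and only
   the remaining conditions compared. *)
move=> P; suff main (w : 'rV_3) : w != 0 -> map_mx j w \in val P ->
    DGZ_curve (j \o i) P <->
    (forall l : 'rV[Fq]_3, l != 0 -> ~ on_line (map_mx (j \o i) l) P).
  by split=> -[A B]; [have [w w0 wP] := B|have [w w0 wP] := A]; split=> //;
    apply/(main w w0 wP).
move=> w0 wP; rewrite -card_Fq in card_Fq3.
(* As [P] has dimension 1, it is spanned by the image of [w]; both conditions then descend to [w] by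
   injectivity of [j]. *)
have PE (v : 'rV[K]_3) : v \in val P -> exists k, v = k *: map_mx j w.
  case: P wP => V /= /eqP dimV wV vV; apply/vlineP.
  suff -> : <[map_mx j w]>%VS = V by [].
  by apply/eqP; rewrite eqEdim -memvE wV dimV dim_vline map_mx_eq0 w0.
have curveE : DGZ_curve (j \o i) P <->
    DGZ_form #|Fq| (w 0 (inord 0)) (w 0 (inord 1)) (w 0 (inord 2)) = 0.
  split=> [/(_ _ wP)|w_eq0 v /PE[k ->]].
    by rewrite meval_DGZ_poly !mxE -rmorph_DGZ_form => /eqP; rewrite fmorph_eq0 => /eqP.
  rewrite meval_DGZ_poly !mxE DGZ_formZ -?rmorph_DGZ_form ?w_eq0 ?rmorph0 ?mulr0 //.
  by apply: ltnW; apply: finNzRing_gt1.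
have lineE (l : 'rV[Fq]_3) : on_line (map_mx (j \o i) l) P <->
    i (l 0 (inord 0)) * w 0 (inord 0) + i (l 0 (inord 1)) * w 0 (inord 1)
      + i (l 0 (inord 2)) * w 0 (inord 2) = 0.
  have jE (c : K) : \sum_n map_mx (j \o i) l 0 n * (c *: map_mx j w) 0 n =
      c * j (\sum_n i (l 0 n) * w 0 n).
    rewrite rmorph_sum mulr_sumr; apply: eq_bigr => n _.
    by rewrite !mxE rmorphM /= mulrCA.
  rewrite -(sum_ord3 (fun n => i (l 0 n) * w 0 n)).
  split=> [/(_ _ wP)|l_eq0 v /PE[c ->]]; last by rewrite jE l_eq0 rmorph0 mulr0.
  by rewrite -[map_mx j w]scale1r jE mul1r => /eqP; rewrite fmorph_eq0 => /eqP.
split=> [/curveE w_eq0 l l0 /lineE|noline].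
  move: w0 l0; rewrite !row3_neq0 => w0 l0 line.
  by have := DGZ_form_line_neq0 card_Fq3 w0 l0 line; rewrite w_eq0 eqxx.
apply/curveE/(@DGZ_form_no_line _ _ i card_Fq3) => a b c abc; apply/eqP => line.
pose l := \row_(k < 3) [:: a; b; c]`_k.
apply: (noline l); first by rewrite row3_neq0 !mxE !inordK.
by apply/lineE; rewrite !mxE !inordK //=.
Qed.
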